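(* Let $\rho$ be a real number with $0<\rho<0.1$, let $d\ge 4$ be an integer, let $r_0=[1,\dots,1]^T\in\mathbb{C}^d$, let $\zeta_1,\dots,\zeta_d$ be the $d$ distinct roots of unity of order $d$ (the complex solutions of $z^d=1$), and let $A=I+\rho U$ with $U=\operatorname{diag}[\zeta_1,\dots,\zeta_d]$. Then the sequence defined by $$r_{n+1}=r_n-\Pi_{Ar_n}r_n,\qquad n\ge 0,$$ satisfies $$\lim_{n\to\infty}\frac{\|r_{n+1}\|}{\|r_n\|}=\rho.$$
   Context: The inner product on $\mathbb{C}^d$ is $(u,v)=\sum_{j=1}^d u_j\overline{v_j}$ and $\|u\|=\sqrt{(u,u)}$. $\Pi_{Ar_n}$ denotes the orthogonal projection onto the line spanned by $Ar_n$, so $r_{n+1}=r_n-\lambda_nAr_n$ with $\lambda_n=(r_n,Ar_n)/(Ar_n,Ar_n)$. (This is the sequence of residuals of the Orthomin(1) iteration for $Ax=r_0$ with zero initial guess.) *)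

(* Defs.v *)
From HB Require Import structures.
From mathcomp Require Import all_boot all_order all_algebra.
From mathcomp Require Import complex.
From mathcomp Require Import all_classical all_reals all_analysis.
Import Order.TTheory GRing.Theory Num.Theory.
Import numFieldNormedType.Exports.

Set Implicit Arguments.
Unset Strict Implicit.
Unset Printing Implicit Defensive.

Local Open Scope ring_scope.

Definition cdot (R : rcfType) (d : nat) (u v : 'cV[R[i]]_d) : R[i] :=
  \sum_(j < d) u j 0 * (v j 0)^*%R.

(* [cdot u u] is a nonnegative real, so its real part loses nothing. *)
Definition cnorm (R : rcfType) (d : nat) (u : 'cV[R[i]]_d) : R :=
  Num.sqrt (complex.Re (cdot u u)).

(* [proj_ortho] acts on row vectors on the right; transposing it gives the
   matrix acting on column vectors on the left. *)
Definition proj_line (R : rcfType) (d : nat) (w : 'cV[R[i]]_d) : 'M[R[i]]_d :=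
  (proj_ortho w^T)^T.

Lemma cdotE (R : rcfType) (d : nat) (u v : 'cV[R[i]]_d) :
  cdot u v = dotmx u^T v^T.
Proof. by rewrite dotmxE !mxE; apply: eq_bigr => j _; rewrite !mxE. Qed.

Lemma proj_lineE (R : rcfType) (d : nat) (w v : 'cV[R[i]]_d) :
  proj_line w *m v = (cdot v w / cdot w w) *: w.
Proof.
rewrite /proj_line -[v in LHS]trmxK -trmx_mul; apply: trmx_inj.
rewrite trmxK linearZ /=; set c := _ / _.
have -> : v^T = c *: w^T + (v^T - c *: w^T) by rewrite addrC subrK.
rewrite mulmxDl [X in X + _ = _]proj_ortho_id ?scalemx_sub //.
rewrite proj_ortho_0 ?addr0 // orthomx1E.
have [w0|wn0] := eqVneq w 0; first by rewrite w0 !trmx0 map_mx0 mulmx0.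
apply/eqP/matrixP => i j; rewrite !ord1 -dotmxE linearBl /= linearZl_LR /=.
rewrite -!cdotE /c mulfVK ?subrr ?mxE //.
by rewrite cdotE dnorm_eq0 trmx_eq0.
Qed.

Lemma cnormE (R : rcfType) (d : nat) (u : 'cV[R[i]]_d) :
  real_complex R (cnorm u) = sqrtC (cdot u u).
Proof.
have : 0 <= cdot u u by rewrite cdotE dnorm_ge0.
rewrite /cnorm; case: (cdot u u) => a b; rewrite lecE /= => /andP[/eqP b0 a0].
apply/eqP; rewrite -(@eqrXn2 _ 2) ?sqrtC_ge0 ?lecE /= ?b0 ?eqxx ?sqrtr_ge0 ?a0 //.
by rewrite sqrtCK -rmorphXn /= sqr_sqrtr.
Qed.

(* Main.v *)
Require Import Defs.
From mathcomp Require Import all_boot all_order all_algebra.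
From mathcomp Require Import complex.
From mathcomp Require Import all_classical all_reals all_analysis.
From mathcomp Require Import ring lra.
Import Order.TTheory GRing.Theory Num.Theory.
Import numFieldNormedType.Exports.
Local Open Scope classical_set_scope.
Local Open Scope ring_scope.
Local Open Scope complex_scope.

(* Put [w_n(j) = |r_n(j)|^2], [x_j = Re zeta_j], and let [c_n] be the mean of [x]
   under the weights [w_n]. Conjugation permutes the roots and preserves [w_n], so
   the step length is real, and one step multiplies [w_n(j)] by
   [t * (1 + s^2 - 2 * s * x_j)] with [s = (rho + c_n) / (1 + rho * c_n)] and [t]
   independent of [j]. The ratio satisfies
   [(|r_(n+1)| / |r_n|)^2 = rho^2 * (1 - c_n^2) / (1 + rho^2 + 2 * rho * c_n)],
   which tends to [rho^2] as soon as [c_n --> - rho]. To first order a step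
   multiplies [c_n + rho] by [1 - 2 * q], where [q] is the mean of [x^2] under
   [w_n]; it is [1/2] for constant weights. Since [s] is comparable to
   [c_n + rho], the oscillation of the weights stays bounded as long as
   [c_n + rho] decays geometrically, and this in turn keeps [q] close enough to
   [1/2] for a contraction. *)

(** * One step on real weights: contraction and invariant *)

Section Reweighting.
Context {R : realFieldType}.

(** [W], [X], [Q] stand for the sums of [w], [w x], [w x^2], [D] for the number of indices, and [m],
    [M] for bounds on the weights. As [X + rho W] is a multiple of [s], a factor [s] splits off the
    new value and leaves roughly [1 - 2 q]. *)
Lemma moment_step_contraction (rho W X Q D a m M : R) :
  0 < rho < 1 / 10 -> 0 <= a <= 1 / 200 -> 0 < m -> M <= (81 / 50 - 24 * a) * m ->
  0 < D -> m * D <= W -> W <= M * D -> m * (D / 2) <= Q -> Q <= M * (D / 2) ->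
  `|X + rho * W| <= a * W ->
  let s := (rho * W + X) / (W + rho * X) in
  [/\ 0 < W + rho * X, `|s| <= 21 / 20 * a,
      (1 + `|s|) ^+ 2 * M <= (81 / 50 - 24 * (7 / 10 * a)) * ((1 - `|s|) ^+ 2 * m) &
      `|(1 + s ^+ 2) * (X + rho * W) - 2 * s * (Q + rho * X)|
        <= (7 / 10 * a) * ((1 + s ^+ 2) * W - 2 * s * X)].
Proof.
move=> /andP[r0 r1] /andP[a0 a1] m0 Mm D0 DW WM mQ QM E s.
have W0 : 0 < W by apply: lt_le_trans DW; rewrite mulr_gt0.
pose c := X / W; pose q := Q / W.
have Xc : X = c * W by rewrite /c; field; rewrite gt_eqF.
have Qq : Q = q * W by rewrite /q; field; rewrite gt_eqF.
(* [q] lies between [m / (2 M)] and [M / (2 m)], and [M / m <= 81/50]. *)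
have q1 : q <= 81 / 100.
  rewrite /q ler_pdivrMr //.
  have : M <= 81 / 50 * m by move: a0 Mm m0; clear; nra.
  move: D0 DW QM; clear; nra.
have q2 : 3 / 10 <= q.
  rewrite /q ler_pdivlMr //.
  have : 3 / 5 * M <= m by move: a0 Mm m0; clear; nra.
  move: D0 WM mQ; clear; nra.
have E1 : `|c + rho| <= a.
  move: E; rewrite Xc -mulrDl normrM (gtr0_norm W0) ler_pM2r //.
have [c1 c2] : c <= 1 / 100 /\ - (11 / 100) <= c.
  move: E1; rewrite ler_norml => /andP[]; move: r0 r1 a0 a1; clear; split; lra.
have [rc1 rc2] : rho * c <= 1 / 100 /\ - (1 / 50) <= rho * c.
  by move: c1 c2 r0 r1; clear; split; nra.
have Ec : 0 < 1 + rho * c by move: rc2; clear; lra.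
have WX : W + rho * X = (1 + rho * c) * W by rewrite Xc; ring.
have Es : s * (1 + rho * c) = c + rho.
  by rewrite /s WX Xc; field; rewrite !gt_eqF.
clearbody s c q.
have u0 := normr_ge0 s.
have us : `|s| <= 21 / 20 * a.
  move: E1; rewrite -Es normrM (gtr0_norm Ec); move: u0 rc2; clear; nra.
split => //; first by rewrite WX mulr_gt0.
  (* To first order the growth of [M / m] costs [4 * 21/20 * 81/50 * a], about [6.8 a]; the slack
     releases [24 * 3/10 * a = 7.2 a]. *)
  have h : (1 + `|s|) ^+ 2 * (81 / 50 - 24 * a)
      <= (81 / 50 - 24 * (7 / 10 * a)) * (1 - `|s|) ^+ 2.
    have : 0 <= `|s| * a by rewrite mulr_ge0.
    move: us u0 a0 a1; clear; nra.
  rewrite [leRHS]mulrA; apply: le_trans (_ : (1 + `|s|) ^+ 2 * (81 / 50 - 24 * a) * m <= _).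
    by rewrite -mulrA ler_wpM2l // exprn_ge0 // addr_ge0.
  by rewrite ler_wpM2r // ltW.
rewrite Xc Qq (_ : _ - _ =
  s * ((1 + s ^+ 2) * (1 + rho * c) - 2 * (q + rho * c)) * W); last first.
  by rewrite -mulrDl -Es; ring.
rewrite !mulrA -mulrBl mulrA normrM (gtr0_norm W0) ler_pM2r //.
have s1 : `|s| <= 1 / 100 by move: a1 us; clear; lra.
have ss : s ^+ 2 <= 1 / 100 by rewrite -real_normK ?num_real //;
  move: `|s| s1 u0; clear => u u1 u0; nra.
have ss0 := sqr_ge0 s.
have k : `|(1 + s ^+ 2) * (1 + rho * c) - 2 * (q + rho * c)| <= 16 / 25.
  by rewrite ler_norml; move: ss ss0 q1 q2 rc1 rc2; clear; move: (s ^+ 2) (rho * c) => S y *;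
  have : 0 <= S * (1 + y) <= 1 / 50; first (apply/andP; split; nra);
  case/andP; rewrite mulrDl mulrDr mul1r => *; apply/andP; split; lra.
have dn : 49 / 50 <= 1 + s ^+ 2 - 2 * s * c.
  have : `|s * c| <= 1 / 100.
    rewrite normrM; have : `|c| <= 1 / 2.
      by rewrite ler_norml; move: c1 c2; clear => *; apply/andP; split; lra.
    have := normr_ge0 c; move: s1 u0; clear; nra.
  rewrite ler_norml => /andP[]; move: ss0; clear; lra.
(* [21/20 * 16/25 = 0.672] is below [7/10 * 49/50 = 0.686], whence the factor [7/10]. *)
rewrite normrM; apply: (@le_trans _ _ (21 / 20 * a * (16 / 25))); first by apply: ler_pM.
move: dn a0; clear; move: (_ + _ - _) => *; nra.
Qed.

Context {I : finType} (x : I -> R).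

Definition mass (w : I -> R) := \sum_j w j.
Definition moment (w : I -> R) := \sum_j w j * x j.
(** This is [(r, Ar) / (Ar, Ar)] for [w j = |r_j|^2] and [x j = Re zeta_j], provided [(r, Ar)] is
    real. *)
Definition step_length (rho : R) (w : I -> R) :=
  (mass w + rho * moment w) / ((1 + rho ^+ 2) * mass w + 2 * rho * moment w).
(* The factor is [|1 - l * (1 + rho * z)|^2] for [|z| = 1] and [Re z = x j]. *)
Definition reweight (rho : R) (w : I -> R) (j : I) :=
  let l := step_length rho w in
  ((1 - l) ^+ 2 + (l * rho) ^+ 2 - 2 * (1 - l) * (l * rho) * x j) * w j.

Hypothesis x1 : forall j, `|x j| <= 1.

Lemma moment_le_mass w : (forall j, 0 <= w j) -> `|moment w| <= mass w.
Proof.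
move=> w0; apply: le_trans (ler_norm_sum _ _ _) _; apply: ler_sum => j _.
by rewrite normrM (ger0_norm (w0 j)) ler_piMr.
Qed.

Lemma step_length_pos rho w : 0 < rho < 1 / 10 -> (forall j, 0 <= w j) -> 0 < mass w ->
  0 < mass w + rho * moment w /\ 0 < (1 + rho ^+ 2) * mass w + 2 * rho * moment w.
Proof.
move=> /andP[r0 r1] /moment_le_mass; rewrite ler_norml => /andP[].
move: (mass w) (moment w) => W X X1 X2 W0; split; first by nra.
have -> : (1 + rho ^+ 2) * W + 2 * rho * X = (1 - rho) ^+ 2 * W + 2 * rho * (X + W) by ring.
have ? : 0 < 1 - rho by lra.
apply: ltr_wpDr; last by rewrite mulr_gt0 // exprn_gt0.
by rewrite mulr_ge0 //; lra.
Qed.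

(** With [l] the step length, [1 - l = s * (l * rho)]. The single parameter [s], which vanishes
    exactly when [c = - rho], then governs how far the factors are from constant. *)
Lemma reweightE rho w j : 0 < rho < 1 / 10 -> (forall j, 0 <= w j) -> 0 < mass w ->
  let s := (rho * mass w + moment w) / (mass w + rho * moment w) in
  reweight rho w j = (step_length rho w * rho) ^+ 2 * ((1 + s ^+ 2 - 2 * s * x j) * w j).
Proof.
move=> hr w0 W0 s; have [h1 h2] := step_length_pos _ _ hr w0 W0.
rewrite /reweight.
have -> : 1 - step_length rho w = s * (step_length rho w * rho).
  rewrite /step_length /s; field; by rewrite !gt_eqF.
ring.
Qed.

Lemma mass_reweight rho w : 0 < rho < 1 / 10 -> (forall j, 0 <= w j) -> 0 < mass w ->
  let s := (rho * mass w + moment w) / (mass w + rho * moment w) in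
  mass (reweight rho w) =
    (step_length rho w * rho) ^+ 2 * ((1 + s ^+ 2) * mass w - 2 * s * moment w).
Proof.
move=> hr w0 W0 s; rewrite {1}/mass (eq_bigr _ (fun j _ => reweightE _ _ j hr w0 W0)).
rewrite -mulr_sumr -/s; congr (_ * _).
rewrite /moment !mulr_sumr -sumrB; apply: eq_bigr => j _; ring.
Qed.

(* The slack [24 * a] absorbs the growth of the ratio [M / m] in all later steps,
   along which [a] shrinks by the factor [7 / 10]: that growth is geometric. *)
Definition balanced (rho a : R) (w : I -> R) :=
  exists m M, [/\ 0 < m, forall j, m <= w j <= M, M <= (81 / 50 - 24 * a) * m
    & `|moment w + rho * mass w| <= a * mass w].

Lemma sum_between (w v : I -> R) m M : (forall j, m <= w j <= M) -> (forall j, 0 <= v j) ->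
  m * \sum_j v j <= \sum_j w j * v j <= M * \sum_j v j.
Proof.
move=> wb v0; rewrite !mulr_sumr; apply/andP; split; apply: ler_sum => j _.
  by rewrite ler_wpM2r //; case/andP: (wb j).
by rewrite ler_wpM2r //; case/andP: (wb j).
Qed.

Let D : R := #|I|%:R.

Hypothesis I0 : (0 < #|I|)%N.
Hypothesis sum_x : \sum_j x j = 0.
Hypothesis sum_xx : \sum_j x j ^+ 2 = D / 2.

Lemma mass_between w m M : (forall j, m <= w j <= M) -> m * D <= mass w <= M * D.
Proof.
move=> wb; have := sum_between _ (fun=> 1) _ _ wb (fun=> ler01).
by rewrite sumr_const (eq_bigr w) // => j _; rewrite mulr1.
Qed.

Lemma mass_gt0 w : (forall j, 0 < w j) -> 0 < mass w.
Proof.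
move=> w0; rewrite /mass; have /card_gt0P [j _] := I0.
by rewrite (bigD1 j) //= ltr_pwDl // sumr_ge0 // => k _; rewrite ltW.
Qed.

Lemma quadratic_factor_between (s y : R) : `|y| <= 1 ->
  (1 - `|s|) ^+ 2 <= 1 + s ^+ 2 - 2 * s * y <= (1 + `|s|) ^+ 2.
Proof.
move=> y1; have : `|s * y| <= `|s| by rewrite normrM ler_piMr.
rewrite ler_norml => /andP[].
have : `|s| ^+ 2 = s ^+ 2 by rewrite real_normK ?num_real.
by move: `|s| => u us *; apply/andP; split; lra.
Qed.

(** The unweighted mean of [x^2] is [1/2], so the bounds on the weights confine [q] around [1/2] and
    the scalar contraction applies. *)
Lemma balanced_reweight rho a w : 0 < rho < 1 / 10 -> 0 <= a <= 1 / 200 ->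
  balanced rho a w -> balanced rho (7 / 10 * a) (reweight rho w).
Proof.
move=> hr ha [m [M [m0 wb Mm E]]].
have w0 j : 0 < w j by case/andP: (wb j) => + _; apply: lt_le_trans.
have W0 := mass_gt0 _ w0.
have wge j : 0 <= w j by rewrite ltW.
have D0 : 0 < D by rewrite ltr0n.
have /andP[mW WM] := mass_between _ _ _ wb.
have /andP[mQ QM] := sum_between _ _ _ _ wb (fun j => sqr_ge0 (x j)).
rewrite sum_xx in mQ QM.
have := moment_step_contraction rho _ (moment w) _ D a m M hr ha m0 Mm D0 mW WM mQ QM E.
move=> /=; set s := (rho * _ + _) / _ => -[WX0 us K E'].
have [_ den0] := step_length_pos _ _ hr wge W0.
set t := (step_length rho w * rho) ^+ 2.
have rE j : reweight rho w j = t * ((1 + s ^+ 2 - 2 * s * x j) * w j).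
  by have := reweightE _ _ j hr wge W0.
have t0 : 0 < t.
  case/andP: hr => r0 _.
  by rewrite exprn_gt0 // mulr_gt0 // divr_gt0.
have s1 : `|s| < 1.
  by apply: le_lt_trans us _; case/andP: ha; lra.
have massE : mass (reweight rho w) = t * ((1 + s ^+ 2) * mass w - 2 * s * moment w).
  by have := mass_reweight _ _ hr wge W0.
have momentE : moment (reweight rho w) =
    t * ((1 + s ^+ 2) * moment w - 2 * s * \sum_j w j * x j ^+ 2).
  rewrite /moment (eq_bigr _ (fun j _ => congr1 (fun z => z * x j) (rE j))).
  rewrite !mulr_sumr -sumrB mulr_sumr; apply: eq_bigr => j _; ring.
(* The old bounds times the extreme values of the factor; [t] cancels in their ratio. *)
exists (t * ((1 - `|s|) ^+ 2 * m)), (t * ((1 + `|s|) ^+ 2 * M)); split.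
- by rewrite mulr_gt0 // mulr_gt0 // exprn_gt0 // subr_gt0.
- move=> j; rewrite rE; have /andP[f1 f2] := quadratic_factor_between s _ (x1 j).
  have /andP[w1 w2] := wb j.
  have f0 : 0 <= (1 - `|s|) ^+ 2 by rewrite sqr_ge0.
  by rewrite !ler_pM2l // !ler_pM ?(ltW m0) // (le_trans f0).
- by rewrite [leRHS]mulrCA ler_pM2l.
- rewrite massE momentE (_ : _ + _ = t * ((1 + s ^+ 2) * (moment w + rho * mass w) -
      2 * s * (\sum_j w j * x j ^+ 2 + rho * moment w))); last by ring.
  by rewrite normrM (gtr0_norm t0) [leRHS]mulrCA ler_pM2l.
Qed.

(** Constant weights have [c = 0], which may be too far from [- rho]. One explicit step, with
    [s = rho], gives [c + rho = rho^3 / (1 + rho^2)], below [1/200], and a ratio of bounds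
    [((1 + rho) / (1 - rho))^2], below [3/2 = 81/50 - 24/200]. *)
Lemma balanced_reweight1 rho : 0 < rho < 1 / 10 ->
  balanced rho (1 / 200) (reweight rho (fun=> 1)).
Proof.
move=> hr; have := hr; case/andP => r0 r1.
have D0 : 0 < D by rewrite ltr0n.
have m1 : mass (fun=> 1) = D by rewrite /mass sumr_const.
have X1 : moment (fun=> 1) = 0.
  by rewrite /moment -[RHS]sum_x; apply: eq_bigr => j _; rewrite mul1r.
set t := (step_length rho (fun=> 1) * rho) ^+ 2.
have rE j : reweight rho (fun=> 1) j = t * (1 + rho ^+ 2 - 2 * rho * x j).
  rewrite reweightE // m1 ?X1 // addr0 mulr0 addr0 mulfK ?gt_eqF //.
  by rewrite mulr1.
have t0 : 0 < t.
  rewrite exprn_gt0 // mulr_gt0 // /step_length m1 X1 !mulr0 !addr0.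
  by rewrite divr_gt0 // mulr_gt0 // ltr_pwDl // sqr_ge0.
exists (t * (1 - rho) ^+ 2), (t * (1 + rho) ^+ 2); split.
- by rewrite mulr_gt0 // exprn_gt0 //; move: r1; lra.
- move=> j; rewrite rE !ler_pM2l //.
  by have := quadratic_factor_between rho _ (x1 j); rewrite (gtr0_norm r0).
- rewrite [leRHS]mulrCA ler_pM2l //; move: r0 r1; nra.
- have -> : mass (reweight rho (fun=> 1)) = t * (1 + rho ^+ 2) * D.
    rewrite /mass (eq_bigr _ (fun j _ => rE j)) -mulr_sumr sumrB -mulr_sumr.
    by rewrite sum_x mulr0 subr0 sumr_const -[_ *+ _]mulr_natr mulrA.
  have -> : moment (reweight rho (fun=> 1)) = - t * rho * D.
    rewrite /moment (eq_bigr (fun j => t * (1 + rho ^+ 2) * x j - 2 * t * rho * x j ^+ 2)).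
      by rewrite sumrB -!mulr_sumr sum_x sum_xx mulr0 sub0r; field.
    by move=> j _; rewrite rE; ring.
  rewrite (_ : _ + _ = t * (rho ^+ 3 * D)); last by ring.
  rewrite ger0_norm; last by rewrite mulr_ge0 ?ltW // mulr_gt0 // exprn_gt0.
  rewrite -[t * _ * D]mulrA [leRHS]mulrCA ler_pM2l // [leRHS]mulrA ler_pM2r //.
  have : rho ^+ 2 <= 1 / 100 by move: r0 r1; nra.
  rewrite exprS; have := sqr_ge0 rho; move: r0 r1; nra.
Qed.

Lemma mass_reweight_ratio rho w :
  0 < rho < 1 / 10 -> (forall j, 0 <= w j) -> 0 < mass w ->
  let c := moment w / mass w in
  mass (reweight rho w) / mass w = rho ^+ 2 * (1 - c ^+ 2) / (1 + rho ^+ 2 + 2 * rho * c).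
Proof.
move=> hr w0 W0 c; have [h1 h2] := step_length_pos _ _ hr w0 W0.
rewrite mass_reweight // /c /step_length.
move: (mass w) (moment w) W0 h1 h2 => W X W0 h1 h2.
by field; rewrite !gt_eqF.
Qed.

End Reweighting.

(** * Convergence of the mass ratio *)

Lemma reweight_limit (R : realType) (I : finType) (x : I -> R) (rho : R) (w : nat -> I -> R) :
  (forall j, `|x j| <= 1) -> (0 < #|I|)%N -> \sum_j x j = 0 ->
  \sum_j x j ^+ 2 = #|I|%:R / 2 -> 0 < rho < 1 / 10 ->
  (forall j, w 0%N j = 1) -> (forall n j, w n.+1 j = reweight x rho (w n) j) ->
  (fun n => mass (w n.+1) / mass (w n)) @ \oo --> rho ^+ 2.
Proof.
move=> x1 I0 sx sxx hr w0 wS.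
have wSE n : w n.+1 = reweight x rho (w n) by apply/funext => j; exact: wS.
(* The index is shifted because the invariant starts after the first step. *)
have bal n : balanced x rho (geometric (1 / 200) (7 / 10) n) (w n.+1).
  elim: n => [|n IH]; rewrite wSE.
    rewrite /= expr0 mulr1 (_ : w 0%N = fun=> 1); last exact/funext.
    exact: balanced_reweight1.
  rewrite /= exprS mulrCA; apply: balanced_reweight => //.
  have q0 : 0 <= (7 / 10 : R) by lra.
  have q1 : (7 / 10 : R) <= 1 by lra.
  have a0 : 0 <= (1 / 200 : R) by lra.
  by rewrite mulr_ge0 ?exprn_ge0 //= ler_piMr ?exprn_ile1.
have wp n j : 0 < w n j.
  case: n => [|n]; first by rewrite w0.
  by have [m [M [m0 wb _ _]]] := bal n; case/andP: (wb j) => + _; apply: lt_le_trans.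
have W0 n : 0 < mass (w n) by apply: mass_gt0.
pose c n := moment x (w n) / mass (w n).
have cS : c n.+1 @[n --> \oo] --> - rho.
  apply/cvgrPdist_le => e e0.
  have g : geometric (1 / 200) (7 / 10) n @[n --> \oo] --> (0 : R).
    by apply: cvg_geometric; rewrite ger0_norm; lra.
  move/cvgrPdist_le : g => /(_ e e0); apply: filterS => n.
  rewrite sub0r normrN; apply: le_trans; apply: le_trans (ler_norm _).
  have [_ [_ [_ _ _ b]]] := bal n.
  rewrite -opprD normrN addrC -(ler_pM2r (W0 n.+1)) -{1}(gtr0_norm (W0 n.+1)) -normrM.
  by rewrite mulrDl /c divfK ?gt_eqF.
have cc : c n @[n --> \oo] --> - rho by rewrite -(cvg_shiftS c).
have E n : mass (w n.+1) / mass (w n) =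
    rho ^+ 2 * (1 - c n * c n) / (1 + rho ^+ 2 + 2 * rho * c n).
  by rewrite wSE mass_reweight_ratio // => j; rewrite ltW.
rewrite (eq_cvg _ _ E).
have den : 1 + rho ^+ 2 + 2 * rho * - rho != 0.
  rewrite gt_eqF //; case/andP: hr => r0 r1; nra.
(* At [c = - rho] the denominator is [1 - rho^2] and cancels. *)
pose L := rho ^+ 2 * (1 - (- rho) * (- rho)) / (1 + rho ^+ 2 + 2 * rho * - rho).
suff : rho ^+ 2 * (1 - c n * c n) / (1 + rho ^+ 2 + 2 * rho * c n) @[n --> \oo] --> L.
  by rewrite (_ : L = rho ^+ 2) // /L; field.
apply: cvgM.
  apply: cvgM; first exact: cvg_cst.
  by apply: cvgB; [exact: cvg_cst|exact: cvgM].
apply: cvgV => //; apply: cvgD; first exact: cvg_cst.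
by apply: cvgM; first exact: cvg_cst.
Qed.

(** * Roots of unity and the complex Orthomin step *)

Section UnityRoots.
Context {R : rcfType}.

Lemma sum_complex (I : finType) (F G : I -> R) :
  \sum_j (F j +i* G j) = (\sum_j F j) +i* (\sum_j G j).
Proof. by elim/big_rec3: _ => [|j a b c _ ->]. Qed.

Definition abs2 (z : R[i]) : R := complex.Re z ^+ 2 + complex.Im z ^+ 2.

Lemma mulcJ_abs2 (z : R[i]) : z * z^*%R = (abs2 z)%:C.
Proof.
case: z => a b; apply/eqP; rewrite eq_complex /abs2 /=.
by apply/andP; split; apply/eqP; ring.
Qed.

Lemma abs2M (y z : R[i]) : abs2 (y * z) = abs2 y * abs2 z.
Proof. case: y z => a b [a' b']; rewrite /abs2 /=; ring. Qed.

Lemma abs2_unity_root (z : R[i]) d : (0 < d)%N -> z ^+ d = 1 -> abs2 z = 1.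
Proof.
move=> d0 zd; apply/eqP.
rewrite -(pexpr_eq1 d0) ?addr_ge0 ?sqr_ge0 //.
have -> : abs2 z ^+ d = abs2 (z ^+ d).
  elim: d {d0 zd} => [|d IH]; last by rewrite !exprS IH abs2M.
  by rewrite !expr0 /abs2 /= expr1n expr0n addr0.
by rewrite zd /abs2 /= expr1n expr0n addr0.
Qed.

(** The [d] distinct values of [zeta] exhaust the roots of [z^d = 1]. This serves for multiplication
    by a root and for conjugation. *)
Lemma unity_root_reindex d (zeta : 'I_d -> R[i]) (f : R[i] -> R[i]) : (0 < d)%N ->
  injective zeta -> (forall j, zeta j ^+ d = 1) ->
  injective f -> (forall j, f (zeta j) ^+ d = 1) ->
  exists2 h : 'I_d -> 'I_d, injective h & forall j, f (zeta j) = zeta (h j).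
Proof.
move=> d0 zi zr fi fr.
have H := @mem_unity_roots _ d (map zeta (enum 'I_d)) d0.
have {}H j : exists k, f (zeta j) == zeta k.
  have : f (zeta j) \in map zeta (enum 'I_d).
    rewrite -H.
    - by rewrite -topredE /= unity_rootE fr.
    - by apply/allP => z /mapP[k _ ->]; rewrite unity_rootE zr.
    - by rewrite map_inj_uniq // enum_uniq.
    - by rewrite size_map size_enum_ord.
  by case/mapP => k _ ->; exists k.
pose h j := xchoose (H j).
have hE j : f (zeta j) = zeta (h j) by apply/eqP; exact: (xchooseP (H j)).
by exists h => // j k /(congr1 zeta); rewrite -!hE => /fi /zi.
Qed.

(** Multiplication by [zeta k] permutes the roots, so the sum is fixed by the factor [zeta k ^+ m],
    which is not 1. *)
Lemma sum_unity_root_exp d (zeta : 'I_d -> R[i]) m : (0 < d)%N ->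
  injective zeta -> (forall j, zeta j ^+ d = 1) ->
  (exists k, zeta k ^+ m != 1) -> \sum_j zeta j ^+ m = 0.
Proof.
move=> d0 zi zr [k zk].
have k0 : zeta k != 0.
  apply/eqP => z0; have := zr k.
  by rewrite z0 expr0n gtn_eqF //= => /eqP; rewrite eq_sym oner_eq0.
have [||h hi hE] := @unity_root_reindex d zeta ( *%R (zeta k)) d0 zi zr.
- exact: mulfI.
- by move=> j; rewrite exprMn !zr mulr1.
have : zeta k ^+ m * \sum_j zeta j ^+ m = \sum_j zeta j ^+ m.
  rewrite [RHS](reindex_inj hi) mulr_sumr; apply: eq_bigr => j _.
  by rewrite -hE exprMn.
move/eqP; rewrite -subr_eq0 -[X in _ - X]mul1r -mulrBl mulf_eq0 subr_eq0 (negPf zk).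
by move/eqP.
Qed.

Lemma exists_exp_neq1 d (zeta : 'I_d -> R[i]) m : injective zeta -> (0 < m < d)%N ->
  exists k, zeta k ^+ m != 1.
Proof.
move=> zi /andP[m0 md]; apply: contrapT => /forallNP H.
have : (size (map zeta (enum 'I_d)) <= m)%N.
  apply: max_unity_roots => //; last by rewrite map_inj_uniq // enum_uniq.
  by apply/allP => z /mapP[k _ ->]; rewrite unity_rootE; have /negP := H k; rewrite negbK.
by rewrite size_map size_enum_ord leqNgt md.
Qed.

Lemma complex_eta (z : R[i]) : z = complex.Re z +i* complex.Im z.
Proof. by case: z. Qed.

Lemma Re_sum (I : finType) (F : I -> R[i]) : complex.Re (\sum_j F j) = \sum_j complex.Re (F j).
Proof. by rewrite (eq_bigr _ (fun j _ => complex_eta (F j))) sum_complex. Qed.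

Lemma cdot_abs2 d (u : 'cV[R[i]]_d) : cdot u u = (\sum_j abs2 (u j 0))%:C.
Proof.
rewrite /cdot (eq_bigr _ (fun j _ => mulcJ_abs2 (u j 0))) sum_complex.
by rewrite [X in _ +i* X]big1.
Qed.

Lemma cnorm_abs2 d (u : 'cV[R[i]]_d) : cnorm u = Num.sqrt (\sum_j abs2 (u j 0)).
Proof. by rewrite /cnorm cdot_abs2. Qed.

(** The vanishing sum is, up to the factor [- rho], the imaginary part of [(v, Av)]; the projection
    coefficient is therefore the real number [step_length]. *)
Lemma orthomin_step d (zeta : 'I_d -> R[i]) (rho : R) (A : 'M[R[i]]_d) (v : 'cV[R[i]]_d) :
  A = 1%:M + rho%:C *: diag_mx (\row_j zeta j) -> (forall j, abs2 (zeta j) = 1) ->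
  \sum_j abs2 (v j 0) * complex.Im (zeta j) = 0 ->
  forall j, abs2 ((v - proj_line (A *m v) *m v) j 0) =
    reweight (fun j => complex.Re (zeta j)) rho (fun j => abs2 (v j 0)) j.
Proof.
move=> hA z1 sym j.
pose w j := abs2 (v j 0); pose x j := complex.Re (zeta j).
have Av k : (A *m v) k 0 = (1 + rho%:C * zeta k) * v k 0.
  rewrite hA mulmxDl mul1mx -scalemxAl mul_diag_mx !mxE; ring.
have num : cdot v (A *m v) = (mass w + rho * moment x w)%:C.
  rewrite /cdot (eq_bigr (fun k =>
    (w k + rho * (w k * x k)) +i* (- rho * (w k * complex.Im (zeta k))))).
    rewrite sum_complex; congr (_ +i* _); last by rewrite -mulr_sumr sym mulr0.
    by rewrite big_split /= -mulr_sumr.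
  move=> k _; rewrite Av /w /x /abs2; case: (v k 0) (zeta k) => a b [p q].
  apply/eqP; rewrite eq_complex /=; apply/andP; split; apply/eqP; ring.
have den : cdot (A *m v) (A *m v) = ((1 + rho ^+ 2) * mass w + 2 * rho * moment x w)%:C.
  rewrite cdot_abs2; congr (_%:C); rewrite !mulr_sumr -big_split; apply: eq_bigr => k _.
  rewrite Av abs2M /= (_ : abs2 (1 + _) = 1 + rho ^+ 2 * abs2 (zeta k) + 2 * rho * x k).
    by rewrite z1 /w; ring.
  rewrite /x /abs2; case: (zeta k) => p q /=; ring.
rewrite proj_lineE num den -fmorph_div /= -/(step_length x rho w).
rewrite /reweight; set l := step_length _ _ _.
have -> : (v - l%:C *: (A *m v)) j 0 = v j 0 - l%:C * (A *m v) j 0 by rewrite !mxE.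
rewrite Av (_ : _ - _ = (1 - l%:C - l%:C * rho%:C * zeta j) * v j 0); last by ring.
rewrite abs2M; congr (_ * _); have := z1 j; rewrite /abs2; case: (zeta j) => p q /= e.
have -> : (l * rho) ^+ 2 = (l * rho) ^+ 2 * (p ^+ 2 + q ^+ 2) by rewrite e mulr1.
ring.
Qed.

End UnityRoots.

(** * Application to the residuals *)

Theorem theorem17 (R : realType) (rho : R) (d : nat)
    (zeta : 'I_d -> R[i]) (U A : 'M[R[i]]_d) (r : nat -> 'cV[R[i]]_d)
    (hrho : 0 < rho < 1 / 10)
    (hd : (4 <= d)%N)
    (zeta_inj : injective zeta)
    (zeta_root : forall j : 'I_d, zeta j ^+ d = 1)
    (hU : U = diag_mx (\row_j zeta j))
    (hA : A = 1%:M + rho%:C *: U)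
    (hr0 : r 0%N = const_mx 1)
    (hrS : forall n : nat, r n.+1 = r n - proj_line (A *m r n) *m r n) :
  (fun n : nat => cnorm (r n.+1) / cnorm (r n)) @ \oo --> rho.
Proof.
have d0 : (0 < d)%N by apply: leq_trans hd.
have z1 j : abs2 (zeta j) = 1 by apply: abs2_unity_root d0 _.
rewrite hU in hA.
pose x j := complex.Re (zeta j); pose w n j := abs2 (r n j 0).
have x1 j : `|x j| <= 1.
  rewrite -(@expr_le1 _ 2) // real_normK ?num_real //.
  by rewrite -(z1 j) /abs2 lerDl sqr_ge0.
have sx : \sum_j x j = 0.
  rewrite -Re_sum.
  have := @sum_unity_root_exp R d zeta 1 d0 zeta_inj zeta_root.
  under eq_bigr do rewrite expr1.
  move=> -> //; apply: exists_exp_neq1 => //; exact: leq_trans hd.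
have sxx : \sum_j x j ^+ 2 = #|'I_d|%:R / 2.
  (* Double-angle formula; the squares of the roots sum to 0 since [2 < d]. *)
  have e j : x j ^+ 2 = (1 + complex.Re (zeta j ^+ 2)) / 2.
    have := z1 j; rewrite /x /abs2; case: (zeta j) => p q /=; lra.
  rewrite (eq_bigr _ (fun j _ => e j)) -mulr_suml big_split /= -Re_sum.
  rewrite sum_unity_root_exp //; last by apply: exists_exp_neq1 => //; exact: leq_trans hd.
  by rewrite /= addr0 sumr_const.
(* [h] is the permutation of the indices induced by conjugation. *)
have [|j|h hi hE] := @unity_root_reindex R d zeta (@conjc R) d0 zeta_inj zeta_root.
- exact: (can_inj (@conjcK R)).
- by rewrite -rmorphXn zeta_root rmorph1.
have xh j : x (h j) = x j by rewrite /x -hE; case: (zeta j).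
have yh j : complex.Im (zeta (h j)) = - complex.Im (zeta j) by rewrite -hE; case: (zeta j).
have sym n : (forall j, w n (h j) = w n j) -> \sum_j w n j * complex.Im (zeta j) = 0.
  move=> wh; set S := \sum_j _.
  have : S = - S.
    by rewrite {1}/S (reindex_inj hi) -sumrN; apply: eq_bigr => j _; rewrite wh yh mulrN.
  by clearbody S; lra.
(* Conditional on symmetry at step [n]: the recursion needs it, and in turn carries it to the next
   step. *)
have wS' n : (forall j, w n (h j) = w n j) -> forall j, w n.+1 j = reweight x rho (w n) j.
  by move=> wh j; rewrite /w hrS; apply: orthomin_step => //; exact: sym.
have wh n : forall j, w n (h j) = w n j.
  elim: n => [|n IH] j; first by rewrite /w hr0 !mxE.
  by rewrite !wS' // /reweight xh IH.
have wS n := wS' n (wh n).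
have w0 j : w 0%N j = 1 by rewrite /w hr0 mxE /abs2 /= expr1n expr0n addr0.
have I0 : (0 < #|'I_d|)%N by rewrite card_ord.
have lim := @reweight_limit R _ x rho w x1 I0 sx sxx hrho w0 wS.
have E n : cnorm (r n.+1) / cnorm (r n) = Num.sqrt (mass (w n.+1) / mass (w n)).
  rewrite !cnorm_abs2 sqrtrM; first rewrite sqrtrV //.
    by rewrite sumr_ge0 // => j _; rewrite addr_ge0 ?sqr_ge0.
  by rewrite sumr_ge0 // => j _; rewrite addr_ge0 ?sqr_ge0.
rewrite (eq_cvg _ _ E).
have -> : rho = Num.sqrt (rho ^+ 2) by rewrite sqrtr_sqr gtr0_norm //; case/andP: hrho.
apply: (continuous_cvg _ _ lim).
exact: sqrt_continuous.
Qed.
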